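(* Let $n \geq 2$ and let $P(z) = \prod_{j=1}^{n}(z - z_j)$ be a polynomial whose zeros $z_1,\dots,z_n \in \mathbb C$ are simple (i.e. pairwise distinct) and lie in the closed unit disk $\overline D(0,1) = \{z\in\mathbb C : |z|\leq 1\}$. Let $$ r = \frac{1}{n}\min_{1\leq j\leq n}\ \min_{i\neq j}|z_i - z_j|, \qquad a_n = n^{\frac{1}{n-1}} - 1, $$ and define $A_n$ as follows: if $n = 2m$ is even, $$ A_{2m} = 2m\left(\frac{r^2 a_{2m}}{24}\right)^m, $$ and if $n = 2m+1$ is odd, $$ A_{2m+1} = (2m+1)\,a_{2m+1}^{\,m+1}\left(\frac{r^2\sqrt3}{72}\right)^m. $$ If $|P(0)| \leq A_n$, then for every $j \in \{1,\dots,n\}$ the closed disk $\{z \in \mathbb C : |z - z_j| \leq 1\}$ contains a zero of $P'$. *)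

(* Defs.v *)
From mathcomp Require Import all_boot all_order all_algebra.
From mathcomp Require Import complex.
From mathcomp Require Import reals exp.
Set Implicit Arguments.
Unset Strict Implicit.
Unset Printing Implicit Defensive.

Import Order.TTheory GRing.Theory Num.Theory.
Local Open Scope ring_scope.

(* The iteration starts from an element of s, so for nonempty s this is the
   minimum of s, with no artificial default; it is 0 for s = [::]. *)
Definition seq_min (R : realDomainType) (s : seq R) : R :=
  \big[Num.min/head 0 s]_(x <- s) x.

Definition poly_of_zeros (R : realType) (n : nat) (z : 'I_n -> R[i]) :
  {poly R[i]} := \prod_(j < n) ('X - (z j)%:P).

(* Normc.normc is the modulus with values in R, whereas `|_| on R[i] takes its
   values in R[i]. *)
Definition scaled_sep (R : realType) (n : nat) (z : 'I_n -> R[i]) : R :=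
  n%:R^-1 *
  seq_min [seq seq_min [seq Normc.normc (z i - z j) | i : 'I_n in predC1 j]
          | j : 'I_n].

Definition a_ (R : realType) (n : nat) : R := n%:R `^ (1 / (n%:R - 1)) - 1.

Definition A_ (R : realType) (n : nat) (r : R) : R :=
  let m := n./2 in
  if odd n then
    n%:R * a_ R n ^+ m.+1 * (r ^+ 2 * Num.sqrt 3 / 72) ^+ m
  else
    n%:R * (r ^+ 2 * a_ R n / 24) ^+ m.

(* Main.v *)
Require Import Defs.
From mathcomp Require Import all_boot all_order all_algebra.
From mathcomp Require Import complex.
From mathcomp Require Import reals exp.
From mathcomp Require Import ring lra zify.
Set Implicit Arguments.
Unset Strict Implicit.
Unset Printing Implicit Defensive.

Import Order.TTheory GRing.Theory Num.Theory.
Local Open Scope ring_scope.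

(** Fix a zero [a = z j] and suppose that every critical point [w] of the
    polynomial [P] satisfies [1 <= |w - a|].

    Two facts hold with [r] the scaled separation.  First,
    [|P'(a)| = n * prod |a - w|] is at least [n], while as the product of the
    [|a - z i|] it is at most [(1 + |a|)^(n-1)]; hence [a_n <= |a|].  Secondly,
    [sum_k 1/(w - z k) = 0] forces every critical point to stay at distance [r]
    from all the zeros, and then to satisfy [|w|^2 <= 1 - r^2]: it is a weighted
    mean of points of the unit disk with variance at least [r^2]
    ([critical_point_far], [gauss_lucas_strict]).

    Therefore [|w|^2 + r^2 <= |w - a|^2]: all the critical points lie on the
    side of [0] of the perpendicular bisector of [[0, a]], with a margin.  The
    bisector theorem forbids this when [P(a) = P(0)]; its quantitative version
    [bisector_gap] says that [|P(a) - P(0)|] is then at least [r^(2m)] for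
    [n = 2m] and [|a| r^(2m) / 2] for [n = 2m+1].  As [P(a) = 0], this is a
    lower bound on [|P(0)|], and it exceeds [A_n] because [a_n <= |a| <= 1]
    ([A_lt]).

    The bisector theorem itself comes from Grace's theorem, in the form of
    [grace_half_plane].  The difference [P(a) - P(0)] is the integral of a
    multiple of [prod (X - w)] over a segment, that is, a linear functional of
    this product.  A linear functional that takes a given value on a product
    of factors [X - w] with all the [w] in a half-plane takes it on some power
    [(X - x)^(n-1)] with [x] in the half-plane, and for such a power the
    integral is the explicit [((1 - x)^n - (-x)^n) / n] after scaling [a] to
    [1]. *)

Local Notation Re := complex.Re.
Local Notation Im := complex.Im.
Local Notation normc := Normc.normc.

(** * Modulus, real part and logarithmic derivative *)

Lemma sqr_normcE (R : rcfType) (x : R[i]) :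
  normc x ^+ 2 = Re x ^+ 2 + Im x ^+ 2.
Proof. by case: x => a b /=; rewrite sqr_sqrtr // addr_ge0 ?sqr_ge0. Qed.

Lemma normc_ge0 (R : rcfType) (x : R[i]) : 0 <= normc x.
Proof. by case: x => a b; rewrite sqrtr_ge0. Qed.

Lemma normc_gt0 (R : rcfType) (x : R[i]) : (0 < normc x) = (x != 0).
Proof.
rewrite lt0r normc_ge0 andbT; congr negb.
by apply/eqP/eqP => [/Normc.eq0_normc|->]; last exact: Normc.normc0.
Qed.

Lemma normc_opp (R : rcfType) (x : R[i]) : normc (- x) = normc x.
Proof. exact: normcN. Qed.

Lemma le_normc_add (R : rcfType) (x y : R[i]) :
  normc (x + y) <= normc x + normc y.
Proof. exact: le_normcD. Qed.

Lemma le_normc_sub (R : rcfType) (x y : R[i]) :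
  normc (x - y) <= normc x + normc y.
Proof. by rewrite -[normc y]normc_opp le_normc_add. Qed.

Lemma normcX (R : rcfType) (x : R[i]) k : normc (x ^+ k) = normc x ^+ k.
Proof.
by elim: k => [|k IHk]; rewrite ?expr0 ?Normc.normc1 // !exprS Normc.normcM IHk.
Qed.

Lemma normc_prod (R : rcfType) (I : Type) (s : seq I) (P : pred I)
    (F : I -> R[i]) :
  normc (\prod_(i <- s | P i) F i) = \prod_(i <- s | P i) normc (F i).
Proof. by apply: big_morph; [exact: Normc.normcM | exact: Normc.normc1]. Qed.

Lemma le_normc_sum (R : rcfType) (I : Type) (s : seq I) (P : pred I)
    (F : I -> R[i]) :
  normc (\sum_(i <- s | P i) F i) <= \sum_(i <- s | P i) normc (F i).
Proof.
elim/big_rec2: _ => [|i y x _ IH]; first by rewrite Normc.normc0.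
by apply: le_trans (le_normc_add _ _) _; rewrite lerD2l.
Qed.

Lemma Re_sum (R : rcfType) (I : Type) (s : seq I) (P : pred I) (F : I -> R[i]) :
  Re (\sum_(i <- s | P i) F i) = \sum_(i <- s | P i) Re (F i).
Proof. by apply: (big_morph (@Re R)) => // -[? ?] [? ?]. Qed.

Lemma Im_sum (R : rcfType) (I : Type) (s : seq I) (P : pred I) (F : I -> R[i]) :
  Im (\sum_(i <- s | P i) F i) = \sum_(i <- s | P i) Im (F i).
Proof. by apply: (big_morph (@Im R)) => // -[? ?] [? ?]. Qed.

Lemma ReB (R : rcfType) (x y : R[i]) : Re (x - y) = Re x - Re y.
Proof. by case: x y => ? ? []. Qed.

Lemma ImB (R : rcfType) (x y : R[i]) : Im (x - y) = Im x - Im y.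
Proof. by case: x y => ? ? []. Qed.

Lemma Re_inv (R : rcfType) (x : R[i]) : Re x^-1 = Re x / normc x ^+ 2.
Proof. by rewrite sqr_normcE; case: x. Qed.

Lemma Im_inv (R : rcfType) (x : R[i]) : Im x^-1 = - Im x / normc x ^+ 2.
Proof. by rewrite sqr_normcE; case: x => a b /=; rewrite mulNr. Qed.

Lemma log_deriv_prod_XsubC (F : fieldType) (I : Type) (s : seq I) (z : I -> F)
    (x : F) :
  let P := \prod_(i <- s) ('X - (z i)%:P) in
  P.[x] != 0 -> P^`().[x] = P.[x] * \sum_(i <- s) (x - z i)^-1.
Proof.
move=> /=; elim: s => [|i s IHs].
  by rewrite !big_nil mulr0 derivE horner0.
rewrite !big_cons hornerM mulf_eq0 negb_or => /andP[xi /IHs IH].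
rewrite derivM derivXsubC mul1r hornerD hornerM IH.
move: xi; rewrite !hornerXsubC => xi; field.
exact: xi.
Qed.

(** * Grace's theorem for a closed half-plane *)

(** Laguerre's theorem on polar derivatives, for a closed half-plane.  Let [r]
    run over the zeros of [f] and put [p = c - Re x], [u r = 1 / (x - r)],
    [U = 1 / (x - zeta)].  At a zero [x] of the polar derivative,
    [sum_r u r = (d+1) U], so [U] is the mean of the [u r] and of zeros that
    complete them to [d+1] points.  The zeros of [f] being beyond the line means
    [Re (u r) < - p |u r|^2], whereas [zeta] being behind it means
    [- p |U|^2 <= Re U].  The first region is convex, has [0] in its closure and
    contains at least one [u r] because [U <> 0]; it must therefore contain [U],
    a contradiction. *)
Lemma laguerre_polar (R : rcfType) (c : R) (d : nat) (f : {poly R[i]}) zeta :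
  (size f <= d.+2)%N ->
  (forall x, Re x <= c -> f.[x] != 0) -> Re zeta <= c ->
  forall x, Re x <= c ->
  (d.+1%:R *: f - ('X - zeta%:P) * f^`()).[x] != 0.
Proof.
move=> szf f0 zc x xc; apply/eqP.
have fx0 := f0 x xc.
have [rs Df] := closed_field_poly_normal f.
have lf0 : lead_coef f != 0.
  by rewrite lead_coef_eq0; apply: contraNneq fx0 => ->; rewrite horner0.
have szrs : (size rs <= d.+1)%N.
  by move: szf; rewrite Df size_scale // size_prod_XsubC ltnS.
have rsc r : r \in rs -> c < Re r.
  move=> rrs; rewrite ltNge; apply/negP => /f0.
  by rewrite Df hornerZ (rootP _) ?root_prod_XsubC // mulr0 eqxx.
pose u r := (x - r)^-1.
have xr0 r : r \in rs -> x - r != 0.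
  move/rsc => rc; apply: contraTneq xc => /eqP; rewrite subr_eq0 => /eqP ->.
  by rewrite -ltNge.
have dfx : f^`().[x] = f.[x] * \sum_(r <- rs) u r.
  move: fx0; rewrite {-3}Df derivZ !hornerZ mulf_eq0 negb_or => /andP[_ px0].
  by rewrite log_deriv_prod_XsubC // mulrA -hornerZ -Df.
rewrite hornerD hornerN hornerM hornerXsubC hornerZ dfx => /eqP.
rewrite mulrCA mulrC -mulrBr mulf_eq0 (negPf fx0) /= subr_eq0 => /eqP sumu.
have xz0 : x - zeta != 0.
  by apply/eqP => xz; move/eqP: sumu; rewrite xz mul0r pnatr_eq0.
set U := (x - zeta)^-1.
have sumU : \sum_(r <- rs) u r = d.+1%:R * U by rewrite sumu mulrC mulKf.
pose p := c - Re x.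
have p0 : 0 <= p by rewrite subr_ge0.
have ReU : - p * normc U ^+ 2 <= Re U.
  rewrite Re_inv Normc.normcV exprVn ler_wpM2r ?invr_ge0 ?sqr_ge0 //.
  by rewrite ReB /p; lra.
(* Convexity enters through the tangent bound
   |u|^2 >= 2 Re (conj(U) u) - |U|^2, which makes the right-hand side affine
   in u before summing. *)
pose tangent v := 2 * (Re U * Re v + Im U * Im v) - normc U ^+ 2.
have Reu r : r \in rs -> Re (u r) < - p * tangent (u r).
  move=> rrs.
  have : Re (u r) < - p * normc (u r) ^+ 2.
    rewrite Re_inv Normc.normcV exprVn.
    rewrite ltr_pM2r ?invr_gt0 ?exprn_gt0 ?normc_gt0 ?xr0 //.
    by rewrite ReB /p; move: (rsc _ rrs); lra.
  move/lt_le_trans; apply; rewrite !mulNr lerN2 ler_wpM2l // /tangent.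
  rewrite -subr_ge0.
  have -> : normc (u r) ^+ 2
      - (2 * (Re U * Re (u r) + Im U * Im (u r)) - normc U ^+ 2)
    = (Re (u r) - Re U) ^+ 2 + (Im (u r) - Im U) ^+ 2.
    by rewrite !sqr_normcE; ring.
  by rewrite addr_ge0 ?sqr_ge0.
have [r0 r0rs] : exists r, r \in rs.
  case: (rs) sumU => [|r s _]; last by exists r; rewrite mem_head.
  rewrite big_nil => /esym/eqP.
  by rewrite mulf_eq0 pnatr_eq0 invr_eq0 (negPf xz0).
have : \sum_(r <- rs) Re (u r) < \sum_(r <- rs) (- p * tangent (u r)).
  rewrite big_seq_cond [ltRHS]big_seq_cond.
  apply: ltr_sum; last by move=> r /andP[/Reu].
  by apply/hasP; exists r0; rewrite ?r0rs.
have mulnc (y : R[i]) : (Re (d.+1%:R * y) = d.+1%:R * Re y) *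
                        (Im (d.+1%:R * y) = d.+1%:R * Im y).
  rewrite !mulr_natl; split; [elim: d.+1 | elim: d.+1] => // e;
    by rewrite !mulrS => <-; case: (y) (y *+ e) => ? ? [].
rewrite -mulr_sumr sumrB big_const_seq iter_addr_0 count_predT.
rewrite -[X in - p * (_ - X)]mulr_natr -mulr_sumr big_split /= -!mulr_sumr.
rewrite -Re_sum -Im_sum sumU !mulnc.
have : (size rs)%:R <= d.+1%:R :> R by rewrite ler_nat.
move: (ler0n R d.+1) ReU; rewrite !sqr_normcE.
move: (Re U) (Im U) => a b; move: d.+1%:R (size rs)%:R => D s H2 D0 H1.
have : 0 <= p * (a ^+ 2 + b ^+ 2) * (D - s).
  by rewrite !mulr_ge0 // ?subr_ge0 // addr_ge0 ?sqr_ge0.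
have : 0 <= D * (a + p * (a ^+ 2 + b ^+ 2)) by rewrite mulr_ge0 //; lra.
by lra.
Qed.

(** The polynomial [x |-> L (q * ('X - x)^d)] for a linear functional [L]
    ([horner_mean_poly]).  The recursion keeps it a formal polynomial, with the
    derivative and the polar derivatives that Grace's theorem needs. *)
Fixpoint mean_poly (F : comNzRingType) (L : {poly F} -> F) (d : nat)
    (q : {poly F}) : {poly F} :=
  if d is e.+1 then mean_poly L e (q * 'X) - 'X * mean_poly L e q else (L q)%:P.

Section MeanPoly.
Context (F : comNzRingType) (L : {poly F} -> F) (linL : scalar L).
Implicit Types q : {poly F}.

Lemma size_mean_poly d q : (size (mean_poly L d q) <= d.+1)%N.
Proof.
elim: d q => [|d IHd] q /=; first exact: size_polyC_leq1.
rewrite (leq_trans (size_polyD _ _)) // geq_max size_polyN.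
rewrite (leq_trans (IHd _)) //=.
by rewrite (leq_trans (size_polyMleq _ _)) // size_polyX /= ltnS.
Qed.

Lemma mean_poly_is_linear d c q1 q2 :
  mean_poly L d (c *: q1 + q2) = c *: mean_poly L d q1 + mean_poly L d q2.
Proof.
elim: d q1 q2 => [|d IHd] q1 q2 /=.
  by rewrite linL polyCD polyCM mul_polyC.
by rewrite mulrDl -scalerAl !IHd mulrDr -scalerAr scalerBr; ring.
Qed.

Lemma deriv_mean_poly d q :
  (mean_poly L d.+1 q)^`() = - (d.+1%:R *: mean_poly L d q).
Proof.
elim: d q => [|d IHd] q.
  by rewrite /= derivB derivM derivX !derivC scale1r; ring.
set e := d.+1 in IHd *.
rewrite [mean_poly L e.+1 q]/= derivB derivM derivX !IHd.
by rewrite -!mul_polyC !polyCMn /= -[e.+1%:R]natr1; ring.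
Qed.

(** With [deriv_mean_poly], this says that the polar derivative of
    [mean_poly L d.+1 q] at [zeta] is [d.+1] times
    [mean_poly L d (q * ('X - zeta))]: a polar derivative turns one of the
    factors [X - x] into [X - zeta]. *)
Lemma mean_poly_XsubC d q zeta :
  mean_poly L d (q * ('X - zeta%:P)) =
  mean_poly L d.+1 q + ('X - zeta%:P) * mean_poly L d q.
Proof.
have -> : q * ('X - zeta%:P) = (- zeta) *: q + q * 'X.
  by rewrite -mul_polyC polyCN; ring.
by rewrite mean_poly_is_linear -mul_polyC polyCN /=; ring.
Qed.

Lemma horner_mean_poly d q x :
  (mean_poly L d q).[x] = L (q * ('X - x%:P) ^+ d).
Proof.
elim: d q => [|d IHd] q; first by rewrite /= hornerC expr0 mulr1.
rewrite /= hornerD hornerN hornerM hornerX !IHd exprS.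
have -> : q * (('X - x%:P) * ('X - x%:P) ^+ d) =
  (- x) *: (q * ('X - x%:P) ^+ d) + q * 'X * ('X - x%:P) ^+ d.
  by rewrite -mul_polyC polyCN; ring.
by rewrite linL; ring.
Qed.
End MeanPoly.

(** Grace's theorem.  Starting from [x |-> L (('X - x)^N)], take the polar
    derivatives at the successive points [w]: each replaces one factor [X - x]
    by [X - w] and preserves the absence of zeros in the half-plane. *)
Theorem grace_half_plane (R : rcfType) (L : {poly R[i]} -> R[i]) (c : R)
    (ws : seq R[i]) :
  scalar L ->
  (forall x, Re x <= c -> L (('X - x%:P) ^+ size ws) != 0) ->
  {in ws, forall w, Re w <= c} ->
  L (\prod_(w <- ws) ('X - w%:P)) != 0.
Proof.
move=> linL Lx wsc.
suff H q x : Re x <= c ->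
    (forall y, Re y <= c -> (mean_poly L (size ws) q).[y] != 0) ->
    L (q * \prod_(w <- ws) ('X - w%:P)) != 0.
  rewrite -[X in L X]mul1r; apply: (H _ (c%:C)%C) => //= y yc.
  by rewrite horner_mean_poly // mul1r Lx.
move=> {Lx} xc.
elim: ws wsc q => [|w ws IHws] wsc q qc.
  by rewrite big_nil mulr1; move: (qc x xc); rewrite hornerC.
rewrite big_cons mulrA; apply: IHws => [v vws|y yc].
  by apply: wsc; rewrite inE vws orbT.
have := laguerre_polar (size_mean_poly L (size ws).+1 q) qc
  (wsc w (mem_head _ _)) yc.
rewrite deriv_mean_poly mulrN opprK -scalerAr -scalerDr -mean_poly_XsubC //.
by rewrite hornerZ mulf_eq0 negb_or => /andP[].
Qed.

(** * A quantitative bisector theorem *)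

(** Put [s = |1 - x|] and [t = |x|], so that [s^2 - t^2 = 1 - 2 Re x].  For an
    even exponent the superadditivity of [y |-> y^m] gives
    [s^(2m) >= t^(2m) + e^m]; an odd one leaves a factor [s], and [s >= 1/2]
    because [s >= t] and [s + t >= 1]. *)
Lemma power_gap (R : rcfType) (x : R[i]) (e : R) (n : nat) :
  (1 < n)%N -> 0 <= e -> e <= 1 - 2 * Re x ->
  2^-1 ^+ odd n * e ^+ n./2 <= normc ((1 - x) ^+ n - (- x) ^+ n).
Proof.
move=> n1 e0 ex.
set s := normc (1 - x); set t := normc x.
have s0 : 0 <= s := normc_ge0 _.
have t0 : 0 <= t := normc_ge0 _.
have st : t ^+ 2 + e <= s ^+ 2.
  by rewrite !sqr_normcE ReB ImB /=; move: ex; nra.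
have lets : t <= s by rewrite -ler_sqr ?nnegrE //; lra.
have s12 : 2^-1 <= s.
  have : normc 1 <= s + t.
    by rewrite -[X in normc X](subrK x); exact: le_normc_add.
  by rewrite Normc.normc1; lra.
have gap : s ^+ n - t ^+ n <= normc ((1 - x) ^+ n - (- x) ^+ n).
  have -> : t ^+ n = normc ((- x) ^+ n) by rewrite normcX normc_opp.
  rewrite lerBlDr /s -normcX.
  by rewrite -[X in normc X <= _](subrK ((- x) ^+ n)); exact: le_normc_add.
apply: le_trans gap.
have even_gap m : (0 < m)%N -> e ^+ m <= s ^+ m.*2 - t ^+ m.*2.
  rewrite -mul2n !exprM => m0.
  apply: le_trans (_ : e ^+ m <= (t ^+ 2 + e) ^+ m - (t ^+ 2) ^+ m) _.
    have : 0 <= t ^+ 2 by exact: sqr_ge0.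
    move: (t ^+ 2) => T T0; case: m m0 => // m _.
    elim: m => [|m IHm]; first by rewrite !expr1; lra.
    rewrite 3!(exprS _ m.+1).
    have : 0 <= e ^+ m.+1 by exact: exprn_ge0.
    have : 0 <= T ^+ m.+1 by exact: exprn_ge0.
    by move: IHm; move: (_ ^+ _) (e ^+ _) (T ^+ _) => A B C; nra.
  by rewrite lerD2r lerXn2r ?nnegrE ?addr_ge0 ?sqr_ge0.
rewrite -[in X in _ <= X](odd_double_half n).
have m0 : (0 < n./2)%N by lia.
case: (odd n); rewrite ?add1n ?add0n ?expr1 ?expr0 ?mul1r ?even_gap //.
have := even_gap _ m0; rewrite !exprS.
have : 0 <= t ^+ (n./2).*2 by exact: exprn_ge0.
have : 0 <= e ^+ n./2 by exact: exprn_ge0.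
by move: (_ ^+ _) (s ^+ _) (t ^+ _) => A B C; nra.
Qed.

(** On polynomials of degree at most [N], the integral over [[0, 1]] plus [k]
    times the coefficient of ['X^N].  This coefficient is [1] on monic
    polynomials of degree [N], so the extra term shifts the integral by [k] on
    them while keeping the functional linear. *)
Definition unit_integral (F : fieldType) (N : nat) (k : F) (q : {poly F}) : F :=
  \sum_(i < N.+1) q`_i / i.+1%:R + k * q`_N.

Lemma unit_integral_is_scalar (F : fieldType) (N : nat) (k : F) :
  scalar (unit_integral N k).
Proof.
move=> c p q; rewrite /unit_integral mulrDr mulr_sumr addrACA -big_split /=.
congr (_ + _); last by rewrite coefD coefZ; ring.
by apply: eq_bigr => i _; rewrite coefD coefZ; ring.
Qed.

Lemma scalarZ_mul (F : comNzRingType) (V : lmodType F) (L : V -> F) c v :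
  scalar L -> L (c *: v) = c * L v.
Proof.
move=> linL; have L0 : L 0 = 0.
  by apply: (addIr (L 0)); rewrite add0r -[X in X + _]mul1r -linL scale1r addr0.
by rewrite -[c *: v]addr0 linL L0 addr0.
Qed.

Lemma unit_integral_deriv (F : numFieldType) (N : nat) (k : F) (q : {poly F}) :
  (size q <= N.+2)%N ->
  unit_integral N k q^`() = q.[1] - q.[0] + k * q^`()`_N.
Proof.
move=> szq; congr (_ + _).
rewrite horner_coef0 (horner_coef_wide _ szq) [in RHS]big_ord_recl expr1n mulr1.
rewrite addrC addKr; apply: eq_bigr => i _.
rewrite coef_deriv /= expr1n mulr1 -[X in X / _]mulr_natr mulfK //.
by rewrite pnatr_eq0.
Qed.

Lemma deriv_factor (R : rcfType) (p : {poly R[i]}) (n : nat) :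
  size p = n.+2 ->
  {ws : seq R[i] | size ws = n &
    p^`() = (n.+1%:R * lead_coef p) *: \prod_(w <- ws) ('X - w%:P)}.
Proof.
move=> szp.
have [ws Dp] := closed_field_poly_normal p^`().
have cn : p^`()`_n = n.+1%:R * lead_coef p.
  by rewrite coef_deriv lead_coefE szp mulr_natl.
have cn0 : p^`()`_n != 0.
  by rewrite cn mulf_neq0 ?pnatr_eq0 // lead_coef_eq0 -size_poly_eq0 szp.
have szd : size p^`() = n.+1.
  apply/anti_leq; rewrite -ltnS -szp lt_size_deriv /=; last first.
    by rewrite -size_poly_eq0 szp.
  by rewrite ltnNge; apply: contra cn0 => /leq_sizeP ->.
have l0 : lead_coef p^`() != 0 by rewrite lead_coefE szd.
exists ws.
  by move: szd; rewrite Dp size_scale // size_prod_XsubC => -[].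
by rewrite {1}Dp lead_coefE szd cn.
Qed.

(** Let [N = n - 1].  The constant [k] below is chosen so that
    [unit_integral N k] vanishes on [prod (X - w)], the product over the
    critical points.  By Grace's theorem it vanishes on some [(X - x)^N] with
    [2 Re x <= 1 - e], that is,
    [(1 - x)^n - (-x)^n = (p(1) - p(0)) / lead_coef p], and [power_gap] bounds
    the left-hand side from below. *)
Theorem endpoint_gap (R : rcfType) (p : {poly R[i]}) (e : R) (n : nat) :
  (1 < n)%N -> size p = n.+1 -> 0 <= e ->
  (forall u, root p^`() u -> 2 * Re u <= 1 - e) ->
  normc (lead_coef p) * (2^-1 ^+ odd n * e ^+ n./2) <= normc (p.[1] - p.[0]).
Proof.
case: n => // n n1 szp e0 pu; rewrite leNgt; apply/negP => small.
have [ws szws Dp] := deriv_factor szp.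
set l := lead_coef p in Dp small *.
have l0 : l != 0 by rewrite lead_coef_eq0 -size_poly_eq0 szp.
have nl0 : n.+1%:R * l != 0 by rewrite mulf_neq0 ?pnatr_eq0.
pose k := - (p.[1] - p.[0]) / (n.+1%:R * l).
have lin := unit_integral_is_scalar n k.
have : unit_integral n k (\prod_(w <- ws) ('X - w%:P)) = 0.
  apply: (mulfI nl0); rewrite mulr0 -(scalarZ_mul _ _ lin) -Dp.
  rewrite unit_integral_deriv ?szp // coef_deriv.
  rewrite -[p`_n.+1]/(p`_n.+2.-1) -szp -lead_coefE -/l -mulr_natl.
  by rewrite divfK // subrr.
apply/eqP; apply: (@grace_half_plane _ _ ((1 - e) / 2)) => //; last first.
  move=> w wws.
  rewrite ler_pdivlMr ?ltr0n // mulrC; apply: pu.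
  by rewrite Dp rootZ ?root_prod_XsubC.
move=> x xe; rewrite szws; apply/eqP => Lx0.
have xe2 : e <= 1 - 2 * Re x by move: xe; rewrite ler_pdivlMr ?ltr0n //; lra.
have := power_gap n1 e0 xe2.
have -> : (1 - x) ^+ n.+1 - (- x) ^+ n.+1 = - (k * n.+1%:R).
  pose q : {poly R[i]} := ('X - x%:P) ^+ n.+1.
  have szq : size q = n.+2 by rewrite size_exp_XsubC.
  have Dq : q^`() = n.+1%:R *: ('X - x%:P) ^+ n.
    by rewrite deriv_exp derivXsubC mul1r scaler_nat.
  have := unit_integral_deriv k (eq_leq szq).
  rewrite {1}Dq scalarZ_mul // Lx0 mulr0 coef_deriv.
  rewrite -[q`_n.+1]/(q`_n.+2.-1) -szq -lead_coefE.
  rewrite (monicP _) ?monic_exp ?monicXsubC // !horner_exp !hornerXsubC sub0r.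
  by move=> /esym/eqP; rewrite addr_eq0 => /eqP.
have -> : k * n.+1%:R = - ((p.[1] - p.[0]) / l).
  by rewrite /k; field; rewrite l0 /= nat1r pnatr_eq0.
rewrite opprK Normc.normcM Normc.normcV ler_pdivlMr ?normc_gt0 // mulrC.
by rewrite leNgt small.
Qed.

(** The hypothesis puts every critical point at a definite distance from the
    perpendicular bisector of [[0, a]], on the side of [0]; for [d = 0] it is
    the half-plane of the classical bisector theorem.  The substitution
    [X := a X] reduces to the segment [[0, 1]]. *)
Theorem bisector_gap (R : rcfType) (p : {poly R[i]}) (a : R[i]) (d : R)
    (n : nat) :
  (1 < n)%N -> size p = n.+1 -> a != 0 -> 0 <= d ->
  (forall w, root p^`() w -> normc w ^+ 2 + d <= normc (w - a) ^+ 2) ->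
  normc (lead_coef p) * ((normc a / 2) ^+ odd n * d ^+ n./2)
    <= normc (p.[a] - p.[0]).
Proof.
move=> n1 szp a0 d0 pw.
have na0 : normc a != 0 by rewrite gt_eqF ?normc_gt0.
have sza : size (a *: 'X : {poly R[i]}) = 2.
  by rewrite size_scale // size_polyX.
pose q := p \Po (a *: 'X).
have szq : size q = n.+1 by rewrite size_comp_poly2.
pose e := d / normc a ^+ 2.
have e0 : 0 <= e by rewrite divr_ge0 ?sqr_ge0.
have qu u : root q^`() u -> 2 * Re u <= 1 - e.
  rewrite deriv_comp rootM derivZ derivX alg_polyC rootC (negPf a0) orbF.
  rewrite root_comp hornerZ hornerX => /pw.
  rewrite -{3}[a]mulr1 -mulrBr !Normc.normcM !exprMn.
  have -> : d = normc a ^+ 2 * e by rewrite mulrC divfK // expf_neq0.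
  rewrite -mulrDr ler_pM2l ?exprn_gt0 ?normc_gt0 // !sqr_normcE ReB ImB /=.
  by lra.
have := endpoint_gap n1 szq e0 qu.
rewrite lead_coef_comp ?sza // lead_coefZ lead_coefX mulr1 szp /=.
rewrite !horner_comp !hornerZ !hornerX mulr1 mulr0 Normc.normcM normcX -mulrA.
congr (_ * _ <= _).
have -> : normc a ^+ n = normc a ^+ odd n * (normc a ^+ 2) ^+ n./2.
  by rewrite -exprM -exprD mul2n odd_double_half.
rewrite /e !expr_div_n exprVn.
by field; rewrite !expf_neq0 ?pnatr_eq0.
Qed.

(** * Critical points of polynomials with separated zeros in the unit disk *)

Section CriticalPoint.
Context (R : realType) (n : nat) (z : 'I_n -> R[i]).

Lemma size_poly_of_zeros : size (poly_of_zeros z) = n.+1.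
Proof.
by rewrite size_prod_XsubC [index_enum _]unlock -enumT size_enum_ord.
Qed.

Lemma poly_of_zeros_monic : poly_of_zeros z \is monic.
Proof. exact: monic_prod_XsubC. Qed.

Lemma poly_of_zeros_root j : (poly_of_zeros z).[z j] = 0.
Proof.
by rewrite /poly_of_zeros (bigD1 j) //= hornerM hornerXsubC subrr mul0r.
Qed.

Lemma deriv_at_zero j :
  (poly_of_zeros z)^`().[z j] = \prod_(i < n | i != j) (z j - z i).
Proof.
rewrite /poly_of_zeros (bigD1 j) //= derivM derivXsubC mul1r hornerD hornerM.
rewrite hornerXsubC subrr mul0r addr0 horner_prod.
by apply: eq_bigr => i _; rewrite hornerXsubC.
Qed.

Lemma critical_point_sum w :
  injective z -> root (poly_of_zeros z)^`() w ->
  (forall j, w - z j != 0) /\ \sum_(j < n) (w - z j)^-1 = 0.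
Proof.
move=> injz w0.
have wz j : w - z j != 0.
  apply: contraTneq w0 => /eqP; rewrite subr_eq0 => /eqP ->.
  rewrite rootE deriv_at_zero; apply/prodf_neq0 => i ij.
  by rewrite subr_eq0; apply: contraNneq ij => /injz ->.
split=> //.
have Pw : (poly_of_zeros z).[w] != 0.
  by rewrite horner_prod; apply/prodf_neq0 => i _; rewrite hornerXsubC.
move/eqP: w0; rewrite /poly_of_zeros log_deriv_prod_XsubC // => /eqP.
by rewrite mulf_eq0 (negPf Pw) => /eqP.
Qed.

(** If [w] were at distance [d < r] from [z j], the other zeros would be farther
    than [(n - 1) r], and the [n - 1] terms [1 / (w - z i)] could not balance
    the term [1 / (w - z j)], whose modulus is [1 / d > 1 / r]. *)
Lemma critical_point_far (r : R) w j :
  injective z -> (forall i k, i != k -> n%:R * r <= normc (z i - z k)) ->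
  root (poly_of_zeros z)^`() w -> r <= normc (w - z j).
Proof.
move=> injz sep w0; have [wz] := critical_point_sum injz w0.
rewrite (bigD1 j) //= => /eqP; rewrite addr_eq0 => /eqP sum0.
set d := normc (w - z j).
have d0 : 0 < d by rewrite normc_gt0.
rewrite leNgt; apply/negP => dr.
have r0 : 0 < r := lt_trans d0 dr.
have n0 : (0 < n)%N := leq_ltn_trans (leq0n j) (ltn_ord j).
have Dn : n%:R = n.-1%:R + 1 :> R by rewrite natr1 prednK.
have far i : i != j -> normc (w - z i)^-1 <= (n.-1%:R * r)^-1.
  move=> ij; rewrite Normc.normcV.
  have : n%:R * r <= normc (w - z i) + d.
    apply: le_trans (sep _ _ ij) _; rewrite [leRHS]addrC.
    have -> : z i - z j = (w - z j) - (w - z i) by ring.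
    exact: le_normc_sub.
  rewrite Dn => far.
  have n1 : (0 < n.-1)%N.
    by move: (ltn_ord i) (ltn_ord j) (ij); rewrite -val_eqE /=; lia.
  rewrite lef_pV2 ?posrE ?mulr_gt0 ?ltr0n ?normc_gt0 //.
  by nra.
have : d^-1 <= r^-1; last by rewrite lef_pV2 ?posrE // leNgt dr.
rewrite /d -Normc.normcV sum0 [X in X <= _]normc_opp.
apply: le_trans (le_normc_sum _ _ _) _.
apply: le_trans (ler_sum _ far) _.
rewrite sumr_const cardC1 card_ord -[leLHS]mulr_natr invfM.
have [->|n1] := posnP n.-1; first by rewrite mulr0 invr_ge0 ltW.
by rewrite mulrAC mulVf ?mul1r // pnatr_eq0 -lt0n.
Qed.

(** As in the proof of the Gauss-Lucas theorem, [w] is the mean of the [z j]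
    with weights proportional to [lam j = 1 / |w - z j|^2].  The gain is the
    variance: in the average of
    [1 >= |z j|^2 = |w|^2 + 2 Re (conj(w) (z j - w)) + |z j - w|^2]
    the middle term vanishes and the last one gives [n / sum_j (lam j)], the
    harmonic mean of the [|w - z j|^2], which is at least [r^2]. *)
Lemma gauss_lucas_strict (r : R) w :
  injective z -> (forall j, normc (z j) <= 1) ->
  0 < r -> (0 < n)%N -> (forall j, r <= normc (w - z j)) ->
  root (poly_of_zeros z)^`() w -> normc w ^+ 2 + r ^+ 2 <= 1.
Proof.
move=> injz z1 r0 n0 far w0; have [wz sum0] := critical_point_sum injz w0.
pose lam j := (normc (w - z j) ^+ 2)^-1.
have lam0 j : 0 < lam j by rewrite invr_gt0 exprn_gt0 ?normc_gt0.
have sumRe : \sum_j lam j * (Re w - Re (z j)) = 0.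
  have := congr1 (@Re R) sum0; rewrite Re_sum /= => {2}<-.
  by apply: eq_bigr => j _; rewrite Re_inv ReB mulrC.
have sumIm : \sum_j lam j * (Im w - Im (z j)) = 0.
  have := congr1 (@Im R) sum0; rewrite Im_sum /= => /(congr1 (-%R)).
  rewrite oppr0 -sumrN => {2}<-.
  by apply: eq_bigr => j _; rewrite Im_inv ImB mulNr opprK mulrC.
have main : n%:R <= (1 - normc w ^+ 2) * \sum_j lam j.
  rewrite -subr_ge0.
  have -> : (1 - normc w ^+ 2) * (\sum_j lam j) - n%:R =
    \sum_j (lam j * (1 - normc w ^+ 2 + 2 * Re w * (Re w - Re (z j))
                      + 2 * Im w * (Im w - Im (z j))) - 1).
    rewrite sumrB sumr_const card_ord; congr (_ - _).
    under [in RHS]eq_bigr => j _ do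
      rewrite mulrDr mulrDr (mulrCA _ (2 * Re w)) (mulrCA _ (2 * Im w)).
    rewrite !big_split /= -!mulr_sumr sumRe sumIm -mulr_suml; ring.
  apply: sumr_ge0 => j _.
  have lamE : lam j * normc (w - z j) ^+ 2 = 1.
    by rewrite mulVf // expf_neq0 // gt_eqF ?normc_gt0.
  rewrite subr_ge0 -[leLHS]lamE ler_pM2l //.
  have : normc (z j) ^+ 2 <= 1 by rewrite expr_le1 ?normc_ge0.
  rewrite !sqr_normcE ReB ImB; lra.
have lamr : \sum_j lam j <= n%:R / r ^+ 2.
  have lamj j : true -> lam j <= (r ^+ 2)^-1.
    rewrite lef_pV2 ?posrE ?exprn_gt0 ?normc_gt0 //.
    by rewrite lerXn2r ?far ?nnegrE ?normc_ge0 ?ltW.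
  apply: le_trans (ler_sum _ lamj) _.
  by rewrite sumr_const card_ord -[leLHS]mulr_natr mulrC.
have n0R : 0 < n%:R :> R by rewrite ltr0n.
have S0 : 0 <= \sum_j lam j by rewrite sumr_ge0 // => j _; exact: ltW.
have w1 : 0 <= 1 - normc w ^+ 2.
  rewrite leNgt; apply/negP => w1; move: main S0 n0R w1.
  by move: (1 - _) (\sum_j _) n%:R => A S N; nra.
have := le_trans main (ler_wpM2l w1 lamr).
rewrite mulrCA -[leLHS]mulr1 ler_pM2l // ler_pdivlMr ?exprn_gt0 // mul1r.
by lra.
Qed.
End CriticalPoint.

(** * The separation and the constants *)

Lemma seq_min_le (R : realDomainType) (s : seq R) x : x \in s -> seq_min s <= x.
Proof.
rewrite /seq_min; elim: s (head 0 s) => // y s IHs x0.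
rewrite inE big_cons ge_min => /predU1P[->|/IHs ->]; first by rewrite lexx.
by rewrite orbT.
Qed.

Lemma seq_min_mem (R : realDomainType) (s : seq R) :
  (0 < size s)%N -> seq_min s \in s.
Proof.
case: s => // x0 s _; rewrite /seq_min /=.
have x0s : x0 \in x0 :: s by rewrite mem_head.
have : {subset x0 :: s <= x0 :: s} by [].
elim: {1 3}(x0 :: s) => [_|y t IHt sub]; first by rewrite big_nil.
rewrite big_cons minEle; case: ifP => _; first by rewrite sub ?mem_head.
by apply: IHt => v vt; rewrite sub // inE vt orbT.
Qed.

Lemma scaled_sep_le (R : realType) (n : nat) (z : 'I_n -> R[i]) i j :
  i != j -> n%:R * scaled_sep z <= normc (z i - z j).
Proof.
move=> ij; have n0 : n%:R != 0 :> R.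
  by rewrite pnatr_eq0 -lt0n (leq_ltn_trans (leq0n i)).
rewrite /scaled_sep mulrA divff // mul1r.
pose m k := seq_min [seq normc (z l - z k) | l : 'I_n in predC1 k].
apply: (@le_trans _ _ (m j)); apply: seq_min_le.
  by apply/imageP; exists j.
by apply/imageP; exists i.
Qed.

Lemma scaled_sep_gt0 (R : realType) (n : nat) (z : 'I_n -> R[i]) :
  (1 < n)%N -> injective z -> 0 < scaled_sep z.
Proof.
move=> n1 injz; rewrite mulr_gt0 ?invr_gt0 ?ltr0n ?(ltnW n1) //.
pose dist j i := normc (z i - z j).
pose closest j := seq_min [seq dist j i | i : 'I_n in predC1 j].
have /imageP[j _ ->] :
    seq_min [seq closest j | j : 'I_n] \in [seq closest j | j : 'I_n].
  by apply: seq_min_mem; rewrite size_map -cardE card_ord ltnW.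
have /imageP[i ij ->] : closest j \in [seq dist j i | i : 'I_n in predC1 j].
  by apply: seq_min_mem; rewrite size_map -cardE cardC1 card_ord; lia.
by rewrite normc_gt0 subr_eq0; apply: contraNneq ij => /injz ->.
Qed.

Lemma a_le (R : realType) (n : nat) (t : R) :
  (1 < n)%N -> 0 <= t -> n%:R <= (1 + t) ^+ n.-1 -> a_ R n <= t.
Proof.
move=> n1 t0 nt; rewrite /a_ lerBlDl.
have n10 : n%:R - 1 = n.-1%:R :> R by rewrite -subn1 natrB // ltnW.
have n1R : 0 < n.-1%:R :> R by rewrite ltr0n; lia.
have t1 : 0 <= 1 + t by lra.
have -> : 1 + t = ((1 + t) ^+ n.-1) `^ (1 / (n%:R - 1)).
  by rewrite n10 -powR_mulrn // -powRrM mul1r divff ?gt_eqF // powRr1.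
by rewrite ge0_ler_powR ?nnegrE ?exprn_ge0 // n10 mul1r invr_ge0 ltW.
Qed.

Lemma a_ge0 (R : realType) (n : nat) : (1 < n)%N -> 0 <= a_ R n.
Proof.
move=> n1; have n1R : 1 <= n%:R :> R by rewrite ler1n ltnW.
rewrite /a_ subr_ge0 -{1}(powRr0 n%:R) ler_powR // mul1r.
by rewrite invr_ge0 subr_ge0.
Qed.

(** Since [a_n <= t <= 1] and [sqrt 3 / 72 <= 1 / 24], the comparison comes down
    to [n <= 2 m + 1 < 24 ^ m / 2] with [m = n./2]. *)
Lemma A_lt (R : realType) (n : nat) (r t : R) :
  (1 < n)%N -> 0 < r -> 0 < t <= 1 -> a_ R n <= t ->
  A_ n r < (t / 2) ^+ odd n * (r ^+ 2) ^+ n./2.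
Proof.
move=> n1 r0 /andP[t0 t1] at_; have a0 := a_ge0 R n1.
have r0' := ltW r0.
rewrite /A_; move: (a_ R n) at_ a0 => a at_ a0.
have rm : 0 < (r ^+ 2) ^+ n./2 by rewrite !exprn_gt0.
have nat_bound m : (0 < m)%N -> (2 * (m.*2.+1) < 24 ^ m)%N.
  case: m => // m _; elim: m => // m IHm; rewrite expnS; lia.
have m0 : (0 < n./2)%N by lia.
have := nat_bound _ m0; rewrite -(ltr_nat R) natrM natrX => bound.
have n2 : n%:R = (odd n)%:R + (n./2).*2%:R :> R.
  by rewrite -natrD odd_double_half.
move: bound; rewrite -[(n./2).*2.+1%:R]natr1 => bound.
have am1 : a ^+ n./2 <= 1 by rewrite expr_le1 //; lra.
have am0 : 0 <= a ^+ n./2 by rewrite exprn_ge0.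
have H0 : 0 < 24 ^+ n./2 :> R by rewrite exprn_gt0.
have k0 : 0 <= (n./2).*2%:R :> R by exact: ler0n.
case: ifP n2 => _ -> /=.
  apply: (@le_lt_trans _ _ ((1 + (n./2).*2%:R) * t * (r ^+ 2 / 24) ^+ n./2)).
    rewrite exprS; apply: ler_pM.
    - by rewrite mulr_ge0 ?mulr_ge0 //; lra.
    - by rewrite exprn_ge0 // divr_ge0 // mulr_ge0 ?sqrtr_ge0 ?sqr_ge0.
    - by rewrite ler_wpM2l ?addr_ge0 // -[t]mulr1 ler_pM.
    rewrite lerXn2r ?nnegrE ?divr_ge0 ?mulr_ge0 ?sqrtr_ge0 ?sqr_ge0 //.
    have : Num.sqrt 3 <= 3 :> R.
      have : Num.sqrt 3 ^+ 2 = 3 :> R by rewrite sqr_sqrtr.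
      by have := sqrtr_ge0 (3 : R); nra.
    have : 0 < r ^+ 2 by rewrite exprn_gt0.
    by nra.
  rewrite expr_div_n mulrA ltr_pdivrMr //.
  move: rm bound; move: ((r ^+ 2) ^+ n./2) (24 ^+ n./2) => S D rm bound.
  have : 0 < t * S * (D - 2 * ((n./2).*2%:R + 1)).
    by rewrite !mulr_gt0 ?subr_gt0.
  by lra.
rewrite add0r mul1r expr_div_n exprMn mulrA ltr_pdivrMr //.
move: rm am0 am1 k0 bound.
move: ((r ^+ 2) ^+ n./2) (24 ^+ n./2) (a ^+ n./2) (_%:R) => S D Am k.
move=> rm am0 am1 k0 bound.
have : 0 <= k * S * (1 - Am) by rewrite mulr_ge0 ?mulr_ge0 ?subr_ge0 // ltW.
have : 0 < S * (D - k) by rewrite mulr_gt0 ?subr_gt0 //; lra.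
by lra.
Qed.

(** * Zeros within distance one of a critical point *)

Lemma n_le_deriv_at_zero (R : realType) (n : nat) (z : 'I_n -> R[i]) j :
  (forall w, root (poly_of_zeros z)^`() w -> 1 <= normc (w - z j)) ->
  n%:R <= normc (poly_of_zeros z)^`().[z j].
Proof.
case: n z j => [z [] // | n z j far].
have [ws szws Dp] := deriv_factor (size_poly_of_zeros z).
move: far; rewrite Dp (monicP (poly_of_zeros_monic z)) mulr1 => far.
have normc_nat : normc n.+1%:R = n.+1%:R :> R.
  by have := @normcMn R 1 n.+1; rewrite Normc.normc1.
rewrite hornerZ Normc.normcM normc_nat ler_peMr // horner_prod normc_prod.
rewrite big_seq; elim/big_rec: _ => // w x wws x1.
rewrite hornerXsubC -normc_opp opprB mulr_ege1 // far //.
by rewrite rootZ ?pnatr_eq0 // root_prod_XsubC.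
Qed.

Lemma deriv_at_zero_le (R : realType) (n : nat) (z : 'I_n -> R[i]) j :
  (forall i, normc (z i) <= 1) ->
  normc (poly_of_zeros z)^`().[z j] <= (1 + normc (z j)) ^+ n.-1.
Proof.
move=> z1; rewrite deriv_at_zero normc_prod.
have -> : n.-1 = #|[pred i : 'I_n | i != j]| by rewrite cardC1 card_ord.
rewrite -prodr_const; apply: ler_prod => i _.
by rewrite normc_ge0 (le_trans (le_normc_sub _ _)) // addrC lerD2r.
Qed.

Theorem theorem1 (R : realType) (n : nat) (z : 'I_n -> R[i]) :
  (2 <= n)%N ->
  injective z ->
  (forall j : 'I_n, Normc.normc (z j) <= 1) ->
  Normc.normc (poly_of_zeros z).[0] <= A_ n (scaled_sep z) ->
  forall j : 'I_n, exists w : R[i],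
    Normc.normc (w - z j) <= 1 /\ root (poly_of_zeros z)^`() w.
Proof.
move=> n1 injz z1 P0 j.
have [//|none] := boolp.pselect
  (exists w, normc (w - z j) <= 1 /\ root (poly_of_zeros z)^`() w).
have far w : root (poly_of_zeros z)^`() w -> 1 <= normc (w - z j).
  move=> w0; rewrite leNgt; apply/negP => /ltW wj.
  by apply: none; exists w.
set a := z j in far none; set P := poly_of_zeros z in P0 far none.
have n_le := le_trans (n_le_deriv_at_zero far) (deriv_at_zero_le j z1).
have a_lt : a_ R n <= normc a by apply: a_le => //; exact: normc_ge0.
have a0 : 0 < normc a.
  rewrite lt0r normc_ge0 andbT; apply: contraTneq n_le; rewrite -/a => ->.
  by rewrite addr0 expr1n -ltNge ltr1n.
have r0 := scaled_sep_gt0 n1 injz; set r := scaled_sep z in P0 r0.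
have gap : normc (lead_coef P) * ((normc a / 2) ^+ odd n * (r ^+ 2) ^+ n./2)
    <= normc (P.[a] - P.[0]).
  apply: bisector_gap; rewrite ?size_poly_of_zeros ?sqr_ge0 -?normc_gt0 //.
  move=> w w0; apply: le_trans (_ : 1 <= _); last first.
    by rewrite expr_ge1 ?normc_ge0 ?far.
  apply: gauss_lucas_strict (w0) => //; first exact: ltnW.
  by move=> k; apply: critical_point_far (w0) => // i l; apply: scaled_sep_le.
move: gap; rewrite (monicP (poly_of_zeros_monic z)) Normc.normc1 mul1r.
rewrite poly_of_zeros_root sub0r normc_opp leNgt => /negP[].
by apply: le_lt_trans P0 (A_lt _ _ _ _); rewrite ?a0 //; exact: z1.
Qed.
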